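(* Let $\mathring h(r)=1$ and let $M=(-\infty,+\infty)\times N$ carry the metrics $g_0=dr^2+\hat G$ and $g=dr^2+G(r)$ described in the context. If the limits $\mathcal M(-\infty)$ and $\mathcal M(+\infty)$ of the relative radial mass $\mathcal M(r)$ at $-\infty$ and $+\infty$ exist (as real numbers) and $R_{rr}\in L^1(M,dr\,d\mu_{\hat{G}})$, then $$\mathcal M(+\infty)-\mathcal M(-\infty)\ \geq\ \int_M R_{rr}\,dr\,d\mu_{\hat{G}},$$ with equality if and only if $g$ is a product (i.e. $G(r)=\widetilde G$ for some fixed, $r$-independent, Riemannian metric $\widetilde G$ on $N$). Moreover, if $g$ is asymptotic to $g_0$ at some $r_0\in[-\infty,+\infty]$, then equality occurs if and only if $g=g_0$.
   Context: Let $n\geq 2$, let $N$ be a compact $(n-1)$-dimensional smooth manifold (with or without boundary), and let $r$ be the coordinate on the interval factor of $M$. All objects are assumed $C^\infty$. $\hat{G}$ is a fixed Riemannian metric on $N$, with Riemannian measure $\mu_{\hat G}$; $\mathring G(r)=\mathring h^2(r)\hat G$; and $G(r)$ is a family of Riemannian metrics on $N$, so that $g=dr^2+G(r)$ is a Riemannian metric on $M$. Let $H$ and $\mathring H$ be the mean curvatures (traces of the Weingarten maps with respect to $\partial_r$) of $N(r)=\{r\}\times N$ relative to $g$ and $g_0$: $H=\frac12\operatorname{Tr}(G^{-1}\partial_rG)$ and $\mathring H=(n-1)\mathring h'/\mathring h$. The relative radial mass is $\mathcal M(r)=\int_N \mathring{h}^{2}(\mathring{H}-H)\,d\mu_{\hat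 G}$. $R_{rr}$ denotes the Ricci curvature of $g$ in the $(\partial_r,\partial_r)$ direction. $g$ is said to be asymptotic to $g_0$ at a point $r_0$ of the closure (in $[-\infty,+\infty]$) of the interval if $\|G-\mathring G\|_{\mathring G}=o(1)$ as $r\to r_0$, uniformly on $N$ (pointwise norm of tensors on $N$ with respect to $\mathring G(r)$); for $r_0$ in the open interval this means that the two metrics coincide on $N(r_0)$. *)

(* Defs.v *)
From HB Require Import structures.
From mathcomp Require Import all_boot all_order all_algebra.
From mathcomp Require Import all_classical all_reals all_analysis.

Set Implicit Arguments.
Unset Strict Implicit.
Unset Printing Implicit Defensive.

Import Order.TTheory GRing.Theory Num.Theory.
Import numFieldNormedType.Exports.

Local Open Scope classical_set_scope.
Local Open Scope ring_scope.

(** * Calculus on open subsets of the half-space *)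

(** The half-space [x_last >= 0]: with the last coordinate as the distinguished
    one, R x half_space d is half_space (1 + d) as soon as d > 0. *)
Definition half_space (R : realType) (d : nat) : set 'rV[R]_d :=
  [set x | forall k : 'I_d, k.+1 = d -> 0 <= x ord0 k].
Arguments half_space : clear implicits.

Definition basis_vec (R : realType) (d : nat) (k : 'I_d) : 'rV[R]_d :=
  delta_mx ord0 k.

(** Partial derivative along the k-th coordinate inside a set [A]. When [A] is
    relatively open in the half-space, this is the usual partial derivative at
    interior points and the one-sided one, where needed, at boundary points. *)
Definition partial (R : realType) (d : nat) (A : set 'rV[R]_d) (k : 'I_d)
    (f : 'rV[R]_d -> R) (x : 'rV[R]_d) : R :=
  lim ((fun t : R => t^-1 * (f (x + t *: basis_vec R k) - f x))
         @ within [set t : R | A (x + t *: basis_vec R k)] (0 : R)^').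

Fixpoint Ck (R : realType) (d k : nat) (V : set 'rV[R]_d)
    (f : 'rV[R]_d -> R) : Prop :=
  (forall x, V x -> {for x, continuous f}) /\
  match k with
  | 0%N => True
  | k'.+1 => forall i : 'I_d,
      (forall x, V x -> derivable f x (basis_vec R i)) /\
      Ck k' V ('D_(basis_vec R i) f)
  end.

(** C^infinity on an arbitrary subset: existence of local smooth extensions to
    open subsets of R^d. *)
Definition smooth_on (R : realType) (d : nat) (A : set 'rV[R]_d)
    (f : 'rV[R]_d -> R) : Prop :=
  forall x, A x -> exists (V : set 'rV[R]_d) (F : 'rV[R]_d -> R),
    [/\ open V, V x, (forall k, Ck k V F)
      & forall y, A y -> V y -> F y = f y].

(** * Manifolds with (possibly empty) boundary *)

(** [param i] is meant to be the inverse of the chart [coord i : dom i -> R^d],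
    and [chart_at p] is the index of some chart around [p]; it serves to
    evaluate at [p] expressions that do not depend on the chart. *)
Record atlas (R : realType) (T : Type) (d : nat) := Atlas {
  idx : Type;
  dom : idx -> set T;
  coord : idx -> T -> 'rV[R]_d;
  param : idx -> 'rV[R]_d -> T;
  chart_at : T -> idx
}.

Definition is_smooth_manifold (R : realType) (T : topologicalType) (d : nat)
    (A : atlas R T d) : Prop :=
  hausdorff_space T /\ @second_countable T /\
  (forall p, dom (chart_at A p) p) /\
  (forall i : idx A,
    open (dom i) /\
    (exists2 V : set 'rV[R]_d, open V &
       coord i @` dom i = V `&` half_space R d) /\
    (forall p, dom i p -> param i (coord i p) = p) /\
    {within dom i, continuous (coord i)} /\
    {within coord i @` dom i, continuous (param i)}) /\
  (forall (i j : idx A) (c : 'I_d),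
    smooth_on (coord i @` (dom i `&` dom j))
      (fun x => coord j (param i x) ord0 c)).

Definition transition_jacobian (R : realType) (T : Type) (d : nat)
    (A : atlas R T d) (i j : idx A) (p : T) : 'M[R]_d :=
  \matrix_(c, a) partial (coord i @` (dom i `&` dom j)) a
    (fun x => coord j (param i x) ord0 c) (coord i p).

(** * Covariant 2-tensors and Riemannian metrics *)

(** A covariant 2-tensor field is given by its matrix of components in each
    chart; the values outside of the domain of the chart are irrelevant. *)
Definition tensor (R : realType) (T : Type) (d : nat) (A : atlas R T d) :=
  idx A -> T -> 'M[R]_d.

Definition tensor_eq (R : realType) (T : Type) (d : nat) (A : atlas R T d)
    (S1 S2 : tensor A) : Prop :=
  forall i p, dom i p -> S1 i p = S2 i p.

Definition is_riemannian (R : realType) (T : Type) (d : nat) (A : atlas R T d)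
    (g : tensor A) : Prop :=
  (forall i a b,
    smooth_on (coord i @` dom i) (fun x => g i (param i x) a b)) /\
  (forall i j p, dom i p -> dom j p ->
    g i p = (transition_jacobian i j p)^T *m g j p
              *m transition_jacobian i j p) /\
  (forall i p, dom i p -> (g i p)^T = g i p /\
    forall v : 'rV[R]_d, v != 0 -> 0 < (v *m g i p *m v^T) ord0 ord0).

(** The norm |S|_g of a 2-tensor: |S|_g^2 = g^{ac} g^{bd} S_{ab} S_{cd}. *)
Definition tensor_norm (R : realType) (T : Type) (d : nat) (A : atlas R T d)
    (g S : tensor A) (p : T) : R :=
  let i := chart_at A p in
  Num.sqrt (\tr (invmx (g i p) *m S i p *m invmx (g i p) *m (S i p)^T)).

(** Gamma^k_{ab} in the chart [i], as a function of the coordinates. *)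
Definition christoffel (R : realType) (T : Type) (d : nat) (A : atlas R T d)
    (g : tensor A) (i : idx A) (k a b : 'I_d) (x : 'rV[R]_d) : R :=
  let D := partial (coord i @` dom i) in
  let gx (a' b' : 'I_d) (y : 'rV[R]_d) := g i (param i y) a' b' in
  2^-1 * \sum_(l < d) invmx (g i (param i x)) k l *
    (D a (gx l b) x + D b (gx l a) x - D l (gx a b) x).

(** Ric_{ab} = d_k Gamma^k_{ab} - d_b Gamma^k_{ak}
      + Gamma^k_{kl} Gamma^l_{ab} - Gamma^k_{bl} Gamma^l_{ak}
    (so that round spheres have positive Ricci curvature). *)
Definition ricci (R : realType) (T : Type) (d : nat) (A : atlas R T d)
    (g : tensor A) (i : idx A) (p : T) : 'M[R]_d :=
  let D := partial (coord i @` dom i) in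
  let Gam := christoffel g i in
  let x := coord i p in
  \matrix_(a, b)
    (\sum_(k < d) (D k (Gam k a b) x - D b (Gam k a k) x) +
     \sum_(k < d) \sum_(l < d)
       (Gam k k l x * Gam l a b x - Gam k b l x * Gam l a k x)).

(** * Riemannian measure *)

(** Lebesgue integral over R^d of a nonnegative Borel function, as an iterated
    integral. *)
Fixpoint integral_rV (R : realType) (d : nat) :
    ('rV[R]_d -> \bar R) -> \bar R :=
  match d with
  | 0%N => fun f => f 0
  | d'.+1 => fun f => (\int[@lebesgue_measure R]_t
      integral_rV (fun y : 'rV[R]_d' => f (row_mx (t%:M : 'rV[R]_1) y)))%E
  end.

Notation borelType T := (g_sigma_algebraType (@open T)).

(** These values on the Borel subsets of the charts determine the measure. *)
Definition is_riemannian_measure (R : realType) (T : ptopologicalType)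
    (d : nat) (A : atlas R T d) (g : tensor A)
    (mu : {measure set (borelType T) -> \bar R}) : Prop :=
  forall (i : idx A) (B : set (borelType T)), measurable B -> B `<=` dom i ->
    mu B = integral_rV (fun x : 'rV[R]_d =>
      (\1_(coord i @` B) x * Num.sqrt (\det (g i (param i x))))%:E).

(** * The cylinder R x N, with the metrics dr^2 + G(r) *)

Definition cyl_atlas (R : realType) (N : Type) (d : nat) (A : atlas R N d) :
    atlas R (R * N)%type (1 + d) :=
  {| idx := idx A;
     dom := fun i => [set z | dom i z.2];
     coord := fun i z => row_mx (z.1%:M : 'rV[R]_1) (coord i z.2);
     param := fun i x => (lsubmx x ord0 ord0, param i (rsubmx x));
     chart_at := fun z => chart_at A z.2 |}.

Definition cyl_metric (R : realType) (N : Type) (d : nat) (A : atlas R N d)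
    (G : R -> tensor A) : tensor (cyl_atlas A) :=
  fun i z => block_mx 1%:M 0 0 (G z.1 i z.2).

Definition warped (R : realType) (N : Type) (d : nat) (A : atlas R N d)
    (h : R -> R) (Ghat : tensor A) : R -> tensor A :=
  fun r i p => h r ^+ 2 *: Ghat i p.

Definition is_product (R : realType) (N : Type) (d : nat) (A : atlas R N d)
    (G : R -> tensor A) : Prop :=
  exists Gt : tensor A, is_riemannian Gt /\ forall r, tensor_eq (G r) Gt.

(** Ricci curvature of dr^2 + G(r) in the direction (d_r, d_r). *)
Definition radial_ricci (R : realType) (N : Type) (d : nat) (A : atlas R N d)
    (G : R -> tensor A) (z : R * N) : R :=
  ricci (cyl_metric G) (chart_at (cyl_atlas A) z) z
    (lshift d ord0) (lshift d ord0).

Definition mean_curvature (R : realType) (N : Type) (d : nat)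
    (A : atlas R N d) (G : R -> tensor A) (r : R) (p : N) : R :=
  let i := chart_at A p in
  2^-1 * \tr (invmx (G r i p) *m
              \matrix_(a, b) derive1 (fun s : R => G s i p a b) r).

Definition model_mean_curvature (R : realType) (d : nat) (h : R -> R) (r : R)
    : R := d%:R * (derive1 h r / h r).

Definition relative_radial_mass (R : realType) (N : ptopologicalType) (d : nat)
    (A : atlas R N d) (mu : {measure set (borelType N) -> \bar R})
    (h : R -> R) (G : R -> tensor A) (r : R) : R :=
  \int[mu]_p (h r ^+ 2 * (model_mean_curvature d h r - mean_curvature G r p)).

(** The filter of real numbers approaching an extended real number. *)
Definition approach (R : realType) (r0 : \bar R) : set_system R :=
  match r0 with
  | r%:E => r^'
  | +oo%E => pinfty_nbhs R
  | -oo%E => ninfty_nbhs R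
  end.

Definition asymptotic (R : realType) (N : Type) (d : nat) (A : atlas R N d)
    (h : R -> R) (Ghat : tensor A) (G : R -> tensor A) (r0 : \bar R) : Prop :=
  forall eps : R, 0 < eps -> \forall r \near approach r0, forall p : N,
    tensor_norm (warped h Ghat r)
      (fun i q => G r i q - warped h Ghat r i q) p <= eps.

(* Main.v *)
Require Import Defs.
From HB Require Import structures.
From mathcomp Require Import all_boot all_order all_algebra.
From mathcomp Require Import all_classical all_reals all_analysis.
From mathcomp Require Import measurable_realfun lra.

(* After this, [coord] is the chart of an atlas, not a vector space
   coordinate. *)
Import Defs.

Set Implicit Arguments.
Unset Strict Implicit.
Unset Printing Implicit Defensive.

Import Order.TTheory GRing.Theory Num.Theory.
Import numFieldNormedType.Exports.

Local Open Scope classical_set_scope.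
Local Open Scope ring_scope.

(** Let W = G^-1 G' / 2 be the Weingarten map of the slices {r} x N, so that
    H = tr W. The Christoffel symbols of dr^2 + G(r) with an index r are the
    entries of W or vanish, and expanding the Ricci tensor gives the Riccati
    equation R_rr = - H' - tr W^2 ([riccati]). As W is self-adjoint for G,
    tr W^2 is a sum of squares: it is nonnegative and vanishes only where
    G' = 0 ([tr_invmx_sqr], through a Cholesky factorization of G).

    With h = 1 the relative radial mass is M(r) = - int_N H(r, .). Integrating
    the Riccati equation over [-a, a] x N gives
      M(a) - M(-a) - int_([-a, a] x N) R_rr = int_N int_(-a)^a tr W^2 dr dmu.
    The right-hand side is nonnegative and nondecreasing in a, and the left-hand
    side tends to M(+oo) - M(-oo) - int R_rr, which proves the inequality
    ([integrated_riccati_le]).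

    If equality holds, the right-hand side is zero for every a, so that for
    almost every p the function tr W^2 vanishes on the line R x {p}
    ([integrated_riccati_eq]), and G(r) at p does not depend on r. The
    Riemannian measure charges every nonempty open set, hence such points p are
    dense, and by continuity G(r) does not depend on r anywhere
    ([is_product_of_ae]). Conversely, for a product W = 0, and both sides are
    zero. Finally, a metric that does not depend on r and is asymptotic to Ghat
    is at distance zero from Ghat ([asymptotic_product]). *)

(** * Positive definite matrices *)

Definition posdef (R : numDomainType) (d : nat) (K : 'M[R]_d) : Prop :=
  K^T = K /\ forall v : 'rV[R]_d, v != 0 -> 0 < (v *m K *m v^T) ord0 ord0.

Lemma tr_mulmx_trmx (R : comNzRingType) (m n : nat) (T : 'M[R]_(m, n)) :
  \tr (T *m T^T) = \sum_i \sum_j T i j ^+ 2.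
Proof.
apply: eq_bigr => i _; rewrite mxE; apply: eq_bigr => j _.
by rewrite mxE expr2.
Qed.

(** Gaussian elimination by blocks: the Schur complement of the first diagonal
    entry is again positive definite. *)
Lemma cholesky (R : rcfType) (d : nat) (K : 'M[R]_d) :
  posdef K -> exists2 B : 'M[R]_d, B \in unitmx & K = B^T *m B.
Proof.
elim: d K => [|d IH] K [Ksym Kpos].
  exists 1%:M; first exact: unitmx1.
  by rewrite trmx1 mulmx1; apply/matrixP => -[].
rewrite -(@submxK _ 1 d 1 d K) in Ksym Kpos *.
move: (@ulsubmx _ 1 d 1 d K) (@ursubmx _ 1 d 1 d K)
      (@dlsubmx _ 1 d 1 d K) (@drsubmx _ 1 d 1 d K) Ksym Kpos => {K} a v w S.
rewrite (@tr_block_mx _ 1 d 1 d) => Ksym Kpos.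
have [_ _ wE Ssym] := @eq_block_mx _ 1 d 1 d _ _ _ _ _ _ _ _ Ksym.
pose c : R := a ord0 ord0.
have aE : a = c%:M by rewrite [LHS]mx11_scalar.
have c_gt0 : 0 < c.
  have := Kpos (row_mx 1%:M 0).
  have -> : row_mx (1%:M : 'M[R]_1) (0 : 'rV[R]_d) != 0.
    apply: contra_neq (oner_neq0 R); rewrite -(@row_mx0 R 1 1 d).
    by move=> /eq_row_mx [/matrixP /(_ ord0 ord0)]; rewrite !mxE eqxx.
  move=> /(_ isT); rewrite (@mul_row_block _ 1 1 d 1 d) !mul1mx !mul0mx !addr0.
  rewrite (@tr_row_mx _ 1 1 d) (@mul_row_col _ 1 1 d).
  by rewrite trmx1 mulmx1 trmx0 mulmx0 addr0.
clearbody c.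
have c_neq0 : c != 0 by rewrite gt_eqF.
have [|B' uB' SB'] := IH (S - c^-1 *: (v^T *m v)).
  split; first by rewrite linearB /= linearZ /= trmx_mul trmxK Ssym.
  move=> u u0.
  (* t minimizes the quadratic form over the vectors [row_mx _ u]. *)
  pose t := - c^-1 *: (u *m v^T).
  have tu0 : row_mx t u != 0.
    by apply: contra_neq u0; rewrite -(@row_mx0 R 1 1 d) => /eq_row_mx [].
  have := Kpos _ tu0; rewrite (@mul_row_block _ 1 1 d 1 d) (@tr_row_mx _ 1 1 d).
  rewrite (@mul_row_col _ 1 1 d).
  have -> : t *m a + u *m w = 0.
    rewrite aE mul_mx_scalar -wE /t scalerA mulrN mulfV // scaleN1r.
    by rewrite addNr.
  rewrite mul0mx add0r mulmxDl addrC mulmxBr mulmxBl.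
  by rewrite /t -!scalemxAl scaleNr -!scalemxAr -scalemxAl !mulmxA.
exists (block_mx (Num.sqrt c)%:M ((Num.sqrt c)^-1 *: v) 0 B').
  rewrite unitmxE (@det_ublock _ 1 d) unitrM -!unitmxE uB' andbT unitmxE.
  by rewrite det_scalar1 unitfE sqrtr_eq0 -ltNge.
have s0 : Num.sqrt c != 0 by rewrite sqrtr_eq0 -ltNge.
rewrite (@tr_block_mx _ 1 d 1 d) (@mulmx_block _ 1 d 1 d 1 d).
rewrite trmx0 !mul0mx !mulmx0 !addr0 !tr_scalar_mx.
congr (@block_mx R 1 d 1 d _ _ _ _).
- by rewrite -scalar_mxM -expr2 sqr_sqrtr ?aE // ltW.
- by rewrite mul_scalar_mx scalerA mulfV // scale1r.
- by rewrite mul_mx_scalar linearZ /= scalerA mulfV // scale1r.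
- rewrite -SB' -scalemxAr linearZ /= -scalemxAl scalerA -invfM -expr2.
  rewrite sqr_sqrtr ?ltW //.
  by rewrite addrCA subrr addr0.
Qed.

Lemma posdef_unitmx (R : rcfType) (d : nat) (K : 'M[R]_d) :
  posdef K -> K \in unitmx.
Proof.
by move=> /cholesky [B uB ->]; rewrite unitmx_mul unitmx_tr uB.
Qed.

(** If K = B^T B, the trace is that of T T^T for the symmetric matrix
    T = B^-T S B^-1, a sum of squares. *)
Lemma tr_invmx_sqr (R : rcfType) (d : nat) (K S : 'M[R]_d) :
  posdef K -> S^T = S ->
  0 <= \tr (invmx K *m S *m invmx K *m S) /\
  (\tr (invmx K *m S *m invmx K *m S) = 0 -> S = 0).
Proof.
move=> /cholesky [B uB ->] Ssym.
have uBT : B^T \in unitmx by rewrite unitmx_tr.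
have -> : invmx (B^T *m B) = invmx B *m invmx B^T.
  apply: (can_inj (mulmxK (_ : B^T *m B \in unitmx))).
    by rewrite unitmx_mul uBT.
  by rewrite mulVmx ?unitmx_mul ?uBT // !mulmxA mulmxKV // mulVmx.
pose T := invmx B^T *m S *m invmx B.
have TT : T^T = T by rewrite /T !trmx_mul Ssym !trmx_inv trmxK mulmxA.
have -> : \tr (invmx B *m invmx B^T *m S *m (invmx B *m invmx B^T) *m S)
    = \tr (T *m T^T).
  rewrite TT /T -!mulmxA mxtrace_mulC; congr (\tr _).
  by rewrite !mulmxA.
rewrite tr_mulmx_trmx; split.
  by apply: sumr_ge0 => i _; apply: sumr_ge0 => j _; exact: sqr_ge0.
move=> /eqP; rewrite psumr_eq0; last first.
  by move=> i _; apply: sumr_ge0 => j _; exact: sqr_ge0.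
move=> /allP T0.
have {}T0 : T = 0.
  apply/matrixP => i j; rewrite [RHS]mxE; apply/eqP; rewrite -sqrf_eq0.
  have := T0 i (mem_index_enum _); rewrite /= psumr_eq0.
    by move=> /allP /(_ j (mem_index_enum _)).
  by move=> k _; exact: sqr_ge0.
have -> : S = B^T *m T *m B by rewrite /T !mulmxA mulmxKV // mulmxV // mul1mx.
by rewrite T0 mulmx0 mul0mx.
Qed.

(** * Matrices of functions and Weingarten maps *)

(** Classes of functions that are closed under the field operations. Traces,
    determinants and inverses of matrices are treated once, and used both for
    the dependence on r (functions of class C^1) and on the point of N
    (continuous functions). *)
Record function_field (R : fieldType) (T : Type) (D : set T)
    (P : (T -> R) -> Prop) : Prop := FunctionField {
  ff_ext : forall f g, (forall t, D t -> f t = g t) -> P f -> P g;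
  ff_cst : forall c : R, P (fun=> c);
  ffD : forall f g, P f -> P g -> P (fun t => f t + g t);
  ffM : forall f g, P f -> P g -> P (fun t => f t * g t);
  ffV : forall f, (forall t, D t -> f t != 0) -> P f -> P (fun t => (f t)^-1)
}.

Section function_field_theory.
Context {R : fieldType} {T : Type} {D : set T} {P : (T -> R) -> Prop}.
Hypothesis FP : function_field D P.

Lemma ff_sum (I : Type) (s : seq I) (Q : pred I) (F : I -> T -> R) :
  (forall i, P (F i)) -> P (fun t => \sum_(i <- s | Q i) F i t).
Proof.
move=> PF; elim: s => [|i s IH].
  by under eq_fun do rewrite big_nil; exact: (ff_cst FP).
under eq_fun do rewrite big_cons.
by case: (Q i) => //; exact: (ffD FP).
Qed.

Lemma ff_prod (I : Type) (s : seq I) (Q : pred I) (F : I -> T -> R) :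
  (forall i, P (F i)) -> P (fun t => \prod_(i <- s | Q i) F i t).
Proof.
move=> PF; elim: s => [|i s IH].
  by under eq_fun do rewrite big_nil; exact: (ff_cst FP).
under eq_fun do rewrite big_cons.
by case: (Q i) => //; exact: (ffM FP).
Qed.

Lemma ff_det (d : nat) (K : T -> 'M[R]_d) :
  (forall a b, P (fun t => K t a b)) -> P (fun t => \det (K t)).
Proof.
move=> PK; apply: ff_sum => s; apply: (ffM FP); first exact: (ff_cst FP).
by apply: ff_prod => a.
Qed.

Lemma ff_invmx (d : nat) (K : T -> 'M[R]_d) (a b : 'I_d) :
  (forall t, D t -> K t \in unitmx) -> (forall a b, P (fun t => K t a b)) ->
  P (fun t => invmx (K t) a b).
Proof.
move=> uK PK.
apply: (ff_ext FP (f := fun t =>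
    (\det (K t))^-1 * ((-1) ^+ (b + a) * \det (row' b (col' a (K t)))))).
  by move=> t Dt; rewrite /invmx (uK _ Dt) !mxE.
apply: (ffM FP).
  apply: (ffV FP); last exact: ff_det.
  by move=> t Dt; rewrite -unitfE -unitmxE uK.
apply: (ffM FP); first exact: (ff_cst FP).
by apply: ff_det => i j; under eq_fun do rewrite !mxE.
Qed.

Lemma ff_mulmx (m n p : nat) (A : T -> 'M[R]_(m, n)) (B : T -> 'M[R]_(n, p))
    (a : 'I_m) (b : 'I_p) :
  (forall a b, P (fun t => A t a b)) -> (forall a b, P (fun t => B t a b)) ->
  P (fun t => (A t *m B t) a b).
Proof.
move=> PA PB; under eq_fun do rewrite mxE.
by apply: ff_sum => j; exact: (ffM FP).
Qed.

End function_field_theory.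

Lemma near_continuous (T U : topologicalType) (f g : T -> U) (x : T) :
  (\forall y \near x, f y = g y) -> {for x, continuous f} ->
  {for x, continuous g}.
Proof.
move=> fg cf; rewrite /prop_for /continuous_at -(nbhs_singleton fg).
exact: cvg_trans (near_eq_cvg fg) cf.
Qed.

Lemma function_field_continuous (R : realType) (T : topologicalType)
    (D : set T) :
  open D -> function_field D (fun f : T -> R =>
    forall t, D t -> {for t, continuous f}).
Proof.
move=> oD.
split=> [f g fg cf|c|f g cf cg|f g cf cg|f f0 cf] t Dt.
- apply: (near_continuous _ (cf t Dt)).
  by apply: filterS (open_nbhs_nbhs (conj oD Dt)) => s /fg.
- exact: cvg_cst.
- by apply: cvgD; [exact: cf|exact: cg].
- by apply: cvgM; [exact: cf|exact: cg].
- by apply: cvgV; [exact: f0|exact: cf].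
Qed.

Definition C1 (R : realType) (f : R -> R) : Prop :=
  exists2 g : R -> R, continuous g & forall r : R, is_derive r (1 : R) f (g r).

Section C1_theory.
Context {R : realType}.
Implicit Types f g : R -> R.

Lemma C1_derivable f r : C1 f -> derivable f r 1.
Proof. by move=> [g _ /(_ r) []]. Qed.

Lemma C1_continuous f : C1 f -> continuous f.
Proof.
move=> Cf r; apply: differentiable_continuous.
exact/derivable1_diffP/C1_derivable.
Qed.

Lemma C1_continuous_derive1 f : C1 f -> continuous (derive1 f).
Proof.
move=> [g cg fg]; suff -> : derive1 f = g by [].
by apply/funext => r; rewrite derive1E; case: (fg r).
Qed.

Lemma function_field_C1 : function_field setT (@C1 R).
Proof.
split=> [f g fg|c|f g|f g Cf Cg|f f0 Cf].
- by have -> : f = g by apply/funext => t; exact: fg.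
- exists (fun=> 0); first by move=> r; exact: cvg_cst.
  by move=> r; exact: is_derive_cst.
- move=> [f' cf' ff'] [g' cg' gg']; exists (fun r => f' r + g' r).
    by move=> r; apply: cvgD; [exact: cf'|exact: cg'].
  by move=> r; apply: is_deriveD.
- have [cf cg] := (C1_continuous Cf, C1_continuous Cg).
  move: Cf Cg => [f' cf' ff'] [g' cg' gg'].
  exists (fun r => f r *: g' r + g r *: f' r); last first.
    by move=> r; apply: is_deriveM.
  by move=> r; apply: cvgD; apply: cvgM;
    [exact: cf|exact: cg'|exact: cg|exact: cf'].
- have cf := C1_continuous Cf; move: Cf => [f' cf' ff'].
  exists (fun r => - (f r) ^- 2 *: f' r).
    move=> r; apply: cvgM; last exact: cf'.
    apply: cvgN; apply: cvgV; first by rewrite expf_neq0 // f0.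
    by apply: cvgM; exact: cf.
  move=> r; have fr0 : f r != 0 by exact: f0.
  have df : derivable f r 1 by case: (ff' r).
  split; first exact: derivableV.
  by rewrite deriveV // derive_val.
Qed.

End C1_theory.

Definition derive1mx (R : realType) (m n : nat) (K : R -> 'M[R]_(m, n)) (r : R)
    : 'M[R]_(m, n) :=
  \matrix_(a, b) derive1 (fun s => K s a b) r.

Definition weingarten (R : realType) (d : nat) (K : R -> 'M[R]_d) (r : R)
    : 'M[R]_d :=
  2^-1 *: (invmx (K r) *m derive1mx K r).

Lemma C1_weingarten (R : realType) (d : nat) (K : R -> 'M[R]_d) a b :
  (forall r, posdef (K r)) -> (forall a b, C1 (fun r => K r a b)) ->
  (forall a b, C1 (derive1 (fun r => K r a b))) ->
  C1 (fun r => weingarten K r a b).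
Proof.
move=> Kpos CK CK'; have FF := @function_field_C1 R.
under eq_fun do rewrite mxE; apply: (ffM FF); first exact: (ff_cst FF).
apply: (ff_mulmx FF) => i j.
  by apply: (ff_invmx FF) => // r _; exact: posdef_unitmx.
by under eq_fun do rewrite mxE; exact: CK'.
Qed.

(** W is self-adjoint for K: derivatives of symmetric matrices are
    symmetric. *)
Lemma tr_weingarten_sqr (R : realType) (d : nat) (K : R -> 'M[R]_d) (r : R) :
  (forall r, posdef (K r)) ->
  0 <= \tr (weingarten K r *m weingarten K r) /\
  (\tr (weingarten K r *m weingarten K r) = 0 -> derive1mx K r = 0).
Proof.
move=> Kpos; have K'sym : (derive1mx K r)^T = derive1mx K r.
  apply/matrixP => a b; rewrite !mxE; congr (derive1 _ r); apply/funext => s.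
  by have [/matrixP /(_ a b)] := Kpos s; rewrite mxE.
have [ge0 eq0] := tr_invmx_sqr (Kpos r) K'sym.
rewrite /weingarten -scalemxAl -scalemxAr scalerA linearZ /= !mulmxA.
split; first by rewrite mulr_ge0 // mulr_ge0 // invr_ge0.
move=> /eqP; rewrite mulf_eq0 => /orP [|/eqP /eq0 //].
by rewrite mulf_eq0 orbb invr_eq0 pnatr_eq0.
Qed.

(** For K1 = J^T K2 J with a constant J, the Weingarten maps are conjugate:
    W1 = J^-1 W2 J. This is the effect of a change of chart. *)
Lemma weingarten_congruence (R : realType) (d : nat) (K1 K2 : R -> 'M[R]_d)
    (J : 'M[R]_d) (r : R) :
  (forall r, posdef (K1 r)) -> (forall r, posdef (K2 r)) ->
  (forall r, K1 r = J^T *m K2 r *m J) ->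
  (forall a b, C1 (fun r => K2 r a b)) ->
  \tr (weingarten K1 r) = \tr (weingarten K2 r).
Proof.
move=> K1pos K2pos K12 CK2.
have uJ : J \in unitmx.
  have := posdef_unitmx (K1pos r); rewrite K12 !unitmx_mul.
  by case/andP.
have uJT : J^T \in unitmx by rewrite unitmx_tr.
have K1' : derive1mx K1 r = J^T *m derive1mx K2 r *m J.
  apply/matrixP => a b; rewrite !mxE.
  have -> : (fun s => K1 s a b) =
      \sum_k (\sum_l (J l a * J k b) *: (fun s => K2 s l k)).
    apply/funext => s; rewrite K12 mxE fct_sumE; apply: eq_bigr => k _.
    rewrite mxE fct_sumE mulr_suml; apply: eq_bigr => l _.
    by rewrite mxE /= fctE mulrAC.
  have dK k l : derivable (fun s => K2 s k l) r 1 by exact: C1_derivable.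
  rewrite derive1E derive_sum => [|k].
    apply: eq_bigr => k _; rewrite derive_sum => [|l]; last exact: derivableZ.
    rewrite mxE mulr_suml; apply: eq_bigr => l _.
    by rewrite deriveZ // !mxE derive1E mulrAC.
  by apply: derivable_sum => l; exact: derivableZ.
rewrite /weingarten !linearZ /= K1' K12; congr (_ * _).
have uK2 := posdef_unitmx (K2pos r).
have -> : invmx (J^T *m K2 r *m J) = invmx J *m invmx (K2 r) *m invmx J^T.
  have u : J^T *m K2 r *m J \in unitmx by rewrite !unitmx_mul uJT uK2.
  apply: (can_inj (mulmxK u)); rewrite mulVmx // !mulmxA mulmxKV // mulmxKV //.
  by rewrite mulVmx.
by rewrite !mulmxA mulmxKV // -!mulmxA mxtrace_mulC !mulmxA mulmxK.
Qed.

(** * Radial derivatives of smooth functions on a cylinder *)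

Definition cyl_point (R : pzRingType) (d : nat) (r : R) (y : 'rV[R]_d)
    : 'rV[R]_(1 + d) :=
  row_mx (r%:M : 'rV[R]_1) y.

Lemma cyl_pointD (R : pzRingType) (d : nat) (h r : R) (y : 'rV[R]_d) :
  cyl_point r y + h *: row_mx 1%:M 0 = cyl_point (h + r) y.
Proof.
by rewrite /cyl_point scale_row_mx add_row_mx scaler0 addr0 scale_scalar_mx
  mulr1 raddfD addrC.
Qed.

Lemma basis_vec0 (R : realType) (d : nat) :
  basis_vec R (lshift d ord0) = row_mx 1%:M 0.
Proof.
apply/rowP => j; rewrite !mxE eqxx /=; case: splitP => k kj.
  by rewrite !mxE !ord1 -val_eqE /= kj ord1.
by rewrite !mxE -val_eqE /= kj.
Qed.

Lemma basis_vecS (R : realType) (d : nat) (c : 'I_d) :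
  basis_vec R (rshift 1 c) = row_mx 0 (basis_vec R c).
Proof.
apply/rowP => j; rewrite !mxE eqxx /=; case: splitP => k kj.
  by rewrite !mxE -val_eqE /= kj ord1.
by rewrite !mxE -val_eqE /= kj eqn_add2l.
Qed.

Lemma cvg_cyl_point (R : realType) (T : topologicalType) (d : nat) (f : T -> R)
    (g : T -> 'rV[R]_d) (t : T) :
  {for t, continuous f} -> {for t, continuous g} ->
  {for t, continuous (fun s => cyl_point (f s) (g s))}.
Proof.
move=> cf cg; apply/cvg_ballP => e e0.
have cf' : \forall s \near t, ball (f t) e (f s) by move/cvg_ballP: cf; apply.
have cg' : \forall s \near t, ball (g t) e (g s) by move/cvg_ballP: cg; apply.
near=> s; split => // i j; rewrite /cyl_point !mxE; case: fintype.split => k.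
  by rewrite !ord1 !mxE eqxx; near: s.
have : mx_ball _ _ _ _ (g t) e (g s) by near: s.
by move=> [_ /(_ i k)].
Unshelve. all: by end_near. Qed.

Section smooth_cylinder.
Context {R : realType} {d : nat}.
Implicit Types (Y : set 'rV[R]_d) (f : 'rV[R]_(1 + d) -> R).

Definition cylinder_over Y : set 'rV[R]_(1 + d) :=
  [set x | exists r, exists2 y, Y y & x = cyl_point r y].

(** Derivatives along the lines r |-> (r, y) are directional derivatives in the
    first coordinate direction; the difference quotients are the same. *)
Lemma derive_cyl_point (F : 'rV[R]_(1 + d) -> R) (s : R) y :
  (derivable (fun r : R => F (cyl_point r y)) s 1 <->
   derivable F (cyl_point s y) (basis_vec R (lshift d ord0))) /\
  'D_1 (fun r : R => F (cyl_point r y)) s =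
  'D_(basis_vec R (lshift d ord0)) F (cyl_point s y).
Proof.
rewrite /derivable /derive basis_vec0.
have -> : (fun h : R => h^-1 *: (((fun r : R => F (cyl_point r y)) \o shift s)
      (h *: (1 : R)) - F (cyl_point s y))) =
    (fun h => h^-1 *: ((F \o shift (cyl_point s y)) (h *: row_mx 1%:M 0)
      - F (cyl_point s y))).
  apply/funext => h; congr (_ *: (_ - _)) => /=; congr (F _).
  by rewrite [RHS]addrC cyl_pointD /GRing.scale /= mulr1.
by [].
Qed.

(** Local smooth extensions control two radial derivatives. The lines in the
    direction r stay in the cylinder, even over a boundary point of Y, so that
    the radial derivatives of f and of its extension coincide on the
    cylinder. *)
Lemma smooth_on_cylinder Y f x :
  smooth_on (cylinder_over Y) f -> cylinder_over Y x ->
  exists V (F0 F1 F2 : 'rV[R]_(1 + d) -> R),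
  [/\ open V /\ V x,
      forall z, V z -> [/\ {for z, continuous F0}, {for z, continuous F1}
        & {for z, continuous F2}]
    & forall s y, Y y -> V (cyl_point s y) ->
      [/\ f (cyl_point s y) = F0 (cyl_point s y),
          is_derive s (1 : R) (fun r => f (cyl_point r y)) (F1 (cyl_point s y))
        & is_derive s (1 : R) (derive1 (fun r => f (cyl_point r y)))
            (F2 (cyl_point s y))]].
Proof.
move=> sf Yx; have [V [F [oV Vx FC Ff]]] := sf x Yx.
pose e : 'rV[R]_(1 + d) := basis_vec R (lshift d ord0).
have [cF /(_ (lshift d ord0)) [dF [cF1 /(_ (lshift d ord0)) [dF1 [cF2 _]]]]] :=
  FC 2.
exists V, F, ('D_e F), ('D_e ('D_e F)); split; first by split.
  by move=> z Vz; split; [exact: cF|exact: cF1|exact: cF2].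
have VF s y : Y y -> V (cyl_point s y) ->
    f (cyl_point s y) = F (cyl_point s y).
  by move=> Yy Vs; rewrite Ff //; exists s, y.
have nearV s y : V (cyl_point s y) -> \forall r \near s, V (cyl_point r y).
  move=> Vs; apply: (@cvg_cyl_point _ _ _ (@idfun R) (fun=> y) s).
  - exact: cvg_id.
  - exact: cvg_cst.
  - exact: open_nbhs_nbhs.
have der1 (s : R) y : Y y -> V (cyl_point s y) ->
    is_derive s (1 : R) (fun r => f (cyl_point r y)) ('D_e F (cyl_point s y)).
  move=> Yy Vs; have [[_ dFs] DFs] := derive_cyl_point F s y.
  have : is_derive s (1 : R) (fun r => F (cyl_point r y))
      ('D_e F (cyl_point s y)).
    by split; [exact/dFs/dF|exact: DFs].
  apply: near_eq_is_derive.
  by apply: filterS (nearV s y Vs) => r Vr; rewrite VF.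
move=> s y Yy Vs; split; [exact: VF|exact: der1|].
have [[_ dFs] DFs] := derive_cyl_point ('D_e F) s y.
have : is_derive s (1 : R) (fun r => 'D_e F (cyl_point r y))
    ('D_e ('D_e F) (cyl_point s y)).
  by split; [exact/dFs/dF1|exact: DFs].
apply: near_eq_is_derive.
apply: filterS (nearV s y Vs) => r Vr.
by rewrite derive1E; case: (der1 r y Yy Vr).
Qed.

Lemma smooth_on_C1 Y f y : smooth_on (cylinder_over Y) f -> Y y ->
  C1 (fun r => f (cyl_point r y)) /\ C1 (derive1 (fun r => f (cyl_point r y))).
Proof.
move=> sf Yy; have local (s : R) :=
  smooth_on_cylinder sf (ex_intro _ s (ex_intro2 _ _ y Yy erefl)).
have cline (s : R) : {for s, continuous (fun r : R => cyl_point r y)}.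
  by apply: cvg_cyl_point; [exact: cvg_id|exact: cvg_cst].
split; [exists (derive1 (fun r => f (cyl_point r y)))|
        exists (derive1 (derive1 (fun r => f (cyl_point r y))))] => s;
  have [V [F0 [F1 [F2 [[oV Vs] cV VF]]]]] := local s.
- have [_ cF1 _] := cV _ Vs; have nV : \forall r \near s, V (cyl_point r y) :=
    cline s _ (open_nbhs_nbhs (conj oV Vs)).
  apply: (@near_continuous R R (fun r => F1 (cyl_point r y)) _ s).
    apply: filterS nV => r Vr; have [_ [_ <-] _] := VF r y Yy Vr.
    by rewrite derive1E.
  exact: (continuous_comp (cline s)).
- have [_ [df Df] _] := VF s y Yy Vs.
  by rewrite derive1E; exact: derivableP.
- have [_ _ cF2] := cV _ Vs; have nV : \forall r \near s, V (cyl_point r y) :=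
    cline s _ (open_nbhs_nbhs (conj oV Vs)).
  apply: (@near_continuous R R (fun r => F2 (cyl_point r y)) _ s).
    apply: filterS nV => r Vr; have [_ _ [_ <-]] := VF r y Yy Vr.
    by rewrite [RHS]derive1E.
  exact: (continuous_comp (cline s)).
- have [_ _ [df Df]] := VF s y Yy Vs.
  by rewrite [X in is_derive _ _ _ X]derive1E; exact: derivableP.
Qed.

Lemma smooth_on_continuous Y f (r : R) (T : topologicalType) (D : set T)
    (u : T -> 'rV[R]_d) :
  smooth_on (cylinder_over Y) f -> open D -> (forall t, D t -> Y (u t)) ->
  (forall t, D t -> {for t, continuous u}) ->
  forall t, D t ->
  {for t, continuous (fun s => f (cyl_point r (u s)))} /\
  {for t, continuous (fun s => derive1 (fun r => f (cyl_point r (u s))) r)}.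
Proof.
move=> sf oD DY cu t Dt.
have [V [F0 [F1 [F2 [[oV Vt] cV VF]]]]] :=
  smooth_on_cylinder sf (ex_intro _ r (ex_intro2 _ _ (u t) (DY t Dt) erefl)).
have cline : {for t, continuous (fun s => cyl_point r (u s))}.
  by apply: cvg_cyl_point; [exact: cvg_cst|exact: cu].
have nV : \forall s \near t, V (cyl_point r (u s)) :=
  cline _ (open_nbhs_nbhs (conj oV Vt)).
have nD : \forall s \near t, D s := open_nbhs_nbhs (conj oD Dt).
have [cF0 cF1 _] := cV _ Vt.
split.
  apply: (@near_continuous _ _ (fun s => F0 (cyl_point r (u s))) _ t).
    by apply: filterS2 nV nD => s Vs /DY Ys; have [-> _ _] := VF r _ Ys Vs.
  exact: (continuous_comp cline).
apply: (@near_continuous _ _ (fun s => F1 (cyl_point r (u s))) _ t).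
  apply: filterS2 nV nD => s Vs /DY Ys; have [_ [_ <-] _] := VF r _ Ys Vs.
  by rewrite derive1E.
exact: (continuous_comp cline).
Qed.

End smooth_cylinder.

(** * The Riccati equation of the slices *)

Lemma dnbhs_right (R : realType) (x : R) (P : set R) :
  x^' P -> x^'+ P.
Proof.
move=> nP; have {}nP : nbhs x [set t | t != x -> P t] by exact: nP.
suff : nbhs x [set t | x < t -> P t] by [].
by apply: filterS nP => t Pt xt; apply: Pt; rewrite gt_eqF.
Qed.

Section cylinder.
Context {R : realType} {N : topologicalType} {d : nat} (A : atlas R N d).
Hypothesis hN : is_smooth_manifold A.

Lemma chart_at_dom (p : N) : dom (chart_at A p) p.
Proof. by case: hN => _ [_ [+ _]]. Qed.

Lemma dom_open (i : idx A) : open (dom i).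
Proof. by case: hN => _ [_ [_ [/(_ i) [+ _] _]]]. Qed.

Lemma coordK (i : idx A) (p : N) : dom i p -> param i (coord i p) = p.
Proof. by case: hN => _ [_ [_ [/(_ i) [_ [_ [+ _]]] _]]]; exact. Qed.

Lemma coord_image (i : idx A) : exists2 V : set 'rV[R]_d, open V &
  coord i @` dom i = V `&` half_space R d.
Proof. by case: hN => _ [_ [_ [/(_ i) [_ [+ _]] _]]]. Qed.

Lemma coord_continuous (i : idx A) (p : N) :
  dom i p -> {for p, continuous (coord i)}.
Proof.
move=> ip; have c : {within dom i, continuous (coord i)}.
  by case: hN => _ [_ [_ [/(_ i) [_ [_ [_ [+ _]]]] _]]].
have := c; rewrite continuous_open_subspace; last exact: dom_open.
by apply; rewrite inE.
Qed.

Definition cyl_image (i : idx A) : set 'rV[R]_(1 + d) :=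
  @coord _ _ _ (cyl_atlas A) i @` dom (i : idx (cyl_atlas A)).

Lemma cyl_imageE (i : idx A) : cyl_image i = cylinder_over (coord i @` dom i).
Proof.
apply/seteqP; split=> [_ [[r p] /= ip <-]|_ [r [_ [p ip <-] ->]]].
  by exists r, (coord i p); first by exists p.
by exists (r, p).
Qed.

Lemma cyl_paramE (i : idx A) (r : R) y :
  @param _ _ _ (cyl_atlas A) i (cyl_point r y) = (r, param i y).
Proof. by rewrite /= /cyl_point row_mxKl row_mxKr !mxE eqxx. Qed.

(** A point of the image of a chart can be moved in every coordinate direction
    by small t > 0: increasing a coordinate stays in the half-space. Without
    this the limit that defines [partial] could be along a trivial filter. *)
Lemma cyl_image_direction_proper (i : idx A) k x : cyl_image i x ->
  ProperFilter (within
    [set t : R | cyl_image i (x + t *: basis_vec R k)] (0 : R)^').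
Proof.
move=> ix; have [V oV VE] := coord_image i.
suff : \forall t \near (0 : R)^'+, cyl_image i (x + t *: basis_vec R k).
  move=> nt; apply: Build_ProperFilter.
  move=> F0; have F0' : \forall t \near (0 : R)^'+,
      ~ cyl_image i (x + t *: basis_vec R k) by exact: dnbhs_right F0.
  have : \forall t \near (0 : R)^'+, False by apply: filterS2 nt F0'.
  by move=> /filter_not_empty.
move: ix; rewrite cyl_imageE VE => -[r [y [Vy Hy] ->]].
have [kE|[c ->]] : k = lshift d ord0 \/ exists c, k = rshift 1 c.
- rewrite -(splitK k); case: fintype.split => j /=; last by right; exists j.
  by left; rewrite ord1.
- rewrite kE basis_vec0; near=> t; rewrite cyl_pointD.
  by exists (t + r), y.
- rewrite basis_vecS; near=> t.
  exists r; exists (y + t *: basis_vec R c); last first.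
    by rewrite /cyl_point scale_row_mx add_row_mx scaler0 addr0.
  split; last first.
    move=> j jd; rewrite !mxE; apply: addr_ge0; first exact: Hy.
    by rewrite mulr_ge0 ?ler0n.
  near: t; apply: dnbhs_right; apply: nbhs_dnbhs.
  have : y + t *: basis_vec R c @[t --> (0 : R)] --> y + 0 *: basis_vec R c.
    by apply: cvgD; [exact: cvg_cst|apply: cvgZr_tmp; exact: cvg_id].
  by rewrite scale0r addr0; apply; exact: open_nbhs_nbhs.
Unshelve. all: by end_near. Qed.

Lemma partial_const (i : idx A) k f x (c : R) : cyl_image i x ->
  (forall z, cyl_image i z -> f z = c) -> partial (cyl_image i) k f x = 0.
Proof.
move=> ix fc; have FF := cyl_image_direction_proper k ix.
apply: (@lim_near_cst _ (@Rhausdorff R) _ _ FF).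
suff : (0 : R)^' [set t : R | cyl_image i (x + t *: basis_vec R k) ->
    t^-1 * (f (x + t *: basis_vec R k) - f x) = 0] by [].
by apply: filterE => t /= it; rewrite !fc // subrr mulr0.
Qed.

(** The whole line through a point of the cylinder stays in it, so that the
    derivative within the cylinder is an ordinary one. *)
Lemma partial_radial (i : idx A) f (r : R) y :
  (coord i @` dom i) y ->
  partial (cyl_image i) (lshift d ord0) f (cyl_point r y) =
  derive1 (fun s : R => f (cyl_point s y)) r.
Proof.
move=> iy; rewrite /partial /derive1 basis_vec0 cyl_imageE.
have -> : [set t : R | cylinder_over (coord i @` dom i)
    (cyl_point r y + t *: row_mx 1%:M 0)] = setT.
  by apply/seteqP; split=> // t _; rewrite /= cyl_pointD; exists (t + r), y.
rewrite withinET.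
have -> : (fun t : R => t^-1 *
      (f (cyl_point r y + t *: row_mx 1%:M 0) - f (cyl_point r y))) =
    (fun t : R => t^-1 *: (f (cyl_point (t + r) y) - f (cyl_point r y))).
  by apply/funext => t; rewrite cyl_pointD.
by [].
Qed.

Implicit Types (i j : idx A) (p q : N) (r : R).

Variable G : R -> tensor A.
Hypothesis hG : forall r : R, is_riemannian (G r).
Hypothesis hg : is_riemannian (cyl_metric G).

Lemma posdef_metric i p r : dom i p -> posdef (G r i p).
Proof. by case: (hG r) => _ [_ +]; apply. Qed.

Lemma cyl_metric0l i z b :
  cyl_metric G i z (lshift d ord0) b = (lshift d ord0 == b)%:R.
Proof.
rewrite /cyl_metric -(splitK b); case: fintype.split => j /=.
  by rewrite block_mxEul (ord1 j) mxE !eqxx.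
by rewrite block_mxEur mxE.
Qed.

Lemma cyl_metric0r i z b :
  cyl_metric G i z b (lshift d ord0) = (lshift d ord0 == b)%:R.
Proof.
rewrite /cyl_metric -(splitK b); case: fintype.split => j /=.
  by rewrite block_mxEul (ord1 j) mxE !eqxx.
by rewrite block_mxEdl mxE.
Qed.

Lemma cyl_metricS i z a b :
  cyl_metric G i z (rshift 1 a) (rshift 1 b) = G z.1 i z.2 a b.
Proof. exact: block_mxEdr. Qed.

Lemma invmx_cyl_metric i p r : dom i p ->
  invmx (cyl_metric G i (r, p)) = block_mx 1%:M 0 0 (invmx (G r i p)).
Proof.
move=> ip; rewrite /cyl_metric invmx_block_diag ?invmx1 //.
rewrite unitmxE det_ublock det1 mul1r -unitmxE.
exact: posdef_unitmx (posdef_metric r ip).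
Qed.

Lemma smooth_metric i a b :
  smooth_on (cylinder_over (coord i @` dom i))
  (fun x => cyl_metric G i (@param _ _ _ (cyl_atlas A) i x) a b).
Proof. by rewrite -cyl_imageE; case: hg => + _; apply. Qed.

Lemma metricE i p r a b : dom i p ->
  cyl_metric G i (@param _ _ _ (cyl_atlas A) i (cyl_point r (coord i p)))
    (rshift 1 a) (rshift 1 b) = G r i p a b.
Proof. by move=> ip; rewrite cyl_paramE cyl_metricS /= coordK. Qed.

Lemma C1_metric i p a b : dom i p ->
  C1 (fun r => G r i p a b) /\ C1 (derive1 (fun r => G r i p a b)).
Proof.
move=> ip; have iy : (coord i @` dom i) (coord i p) by exists p.
have := smooth_on_C1 (smooth_metric (rshift 1 a) (rshift 1 b)) iy.
by under eq_fun do rewrite metricE //.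
Qed.

Lemma continuous_metric i p r a b : dom i p ->
  {for p, continuous (fun q => G r i q a b)} /\
  {for p, continuous (fun q => derive1 (fun s => G s i q a b) r)}.
Proof.
move=> ip.
have [c0 c1] := smooth_on_continuous r (smooth_metric (rshift 1 a) (rshift 1 b))
  (@dom_open i) (fun t it => ex_intro2 _ _ t it erefl)
  (@coord_continuous i) ip.
have nD : \forall q \near p, dom i q := open_nbhs_nbhs (conj (@dom_open i) ip).
split; [move: c0|move: c1]; apply: near_continuous; apply: filterS nD => q iq.
  by rewrite metricE.
by under eq_fun do rewrite metricE //.
Qed.

Lemma cyl_image_point i p r : dom i p -> cyl_image i (cyl_point r (coord i p)).
Proof. by move=> ip; exists (r, p). Qed.

Lemma partial_metric0l i k b x : cyl_image i x ->
  partial (cyl_image i) k (fun y => cyl_metric G i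
    (@param _ _ _ (cyl_atlas A) i y) (lshift d ord0) b) x = 0.
Proof.
by move=> ix; apply: (@partial_const i k _ x _ ix) => z _; exact: cyl_metric0l.
Qed.

Lemma partial_metric0r i k a x : cyl_image i x ->
  partial (cyl_image i) k (fun y => cyl_metric G i
    (@param _ _ _ (cyl_atlas A) i y) a (lshift d ord0)) x = 0.
Proof.
by move=> ix; apply: (@partial_const i k _ x _ ix) => z _; exact: cyl_metric0r.
Qed.

(** The three families of Christoffel symbols that occur in R_rr. The entries
    g_(0 b) are constant, so that only the derivatives d_r g_(a b) of the
    tangential block survive. *)
Lemma christoffel00 i k x : cyl_image i x ->
  christoffel (cyl_metric G) i k (lshift d ord0) (lshift d ord0) x = 0.
Proof.
move=> ix; rewrite /christoffel big1 ?mulr0 // => l _.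
by rewrite !partial_metric0r // addr0 subr0 mulr0.
Qed.

Lemma christoffel0b i p r b : dom i p ->
  christoffel (cyl_metric G) i (lshift d ord0) (lshift d ord0) b
    (cyl_point r (coord i p)) = 0.
Proof.
move=> ip; have ix := cyl_image_point r ip.
rewrite /christoffel cyl_paramE coordK // invmx_cyl_metric //.
rewrite big_split_ord big_ord1 /= big1 => [|l _]; last first.
  by rewrite block_mxEur mxE mul0r.
by rewrite !partial_metric0l // !addr0 subr0 !mulr0.
Qed.

Lemma christoffel_weingarten i p r k b : dom i p ->
  christoffel (cyl_metric G) i (rshift 1 k) (lshift d ord0) (rshift 1 b)
    (cyl_point r (coord i p)) = weingarten (fun s => G s i p) r k b.
Proof.
move=> ip; have ix := cyl_image_point r ip.
have iy : (coord i @` dom i) (coord i p) by exists p.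
rewrite /christoffel cyl_paramE coordK // invmx_cyl_metric //.
rewrite big_split_ord big_ord1 /= block_mxEdl mxE mul0r add0r.
rewrite mxE; congr (_ * _); rewrite mxE; apply: eq_bigr => l _.
rewrite block_mxEdr; congr (_ * _).
rewrite partial_metric0r // partial_metric0l // addr0 subr0.
rewrite partial_radial // mxE.
by under eq_fun do rewrite metricE //.
Qed.

(** The squared norm of the second fundamental form of the slice. *)
Definition shape_norm2 (i : idx A) (p : N) (r : R) : R :=
  \tr (weingarten (fun s => G s i p) r *m weingarten (fun s => G s i p) r).

(** With Gamma^k_00 = Gamma^0_0b = 0 and Gamma^k_0b = W_kb, the formula for the
    Ricci tensor reduces to R_00 = - d_0 (Gamma^k_0k)
    - Gamma^k_0l Gamma^l_0k. *)
Lemma riccati p r :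
  radial_ricci G (r, p) =
  - derive1 (fun s => \tr (weingarten (fun s => G s (chart_at A p) p) s)) r
  - shape_norm2 (chart_at A p) p r.
Proof.
pose i : idx A := chart_at A p.
rewrite /radial_ricci (_ : chart_at (cyl_atlas A) (r, p) = i) // /ricci -/i.
have ip : dom i p := chart_at_dom p.
have -> : @coord _ _ _ (cyl_atlas A) i (r, p) = cyl_point r (coord i p) by [].
have ix := cyl_image_point r ip.
have iy : (coord i @` dom i) (coord i p) by exists p.
rewrite mxE; congr (_ + _).
  under eq_bigr => k _.
    rewrite (@partial_const i k _ _ 0 ix (@christoffel00 i k)).
    rewrite sub0r; over.
  rewrite sumrN; congr (- _).
  rewrite big_split_ord big_ord1 /=.
  rewrite partial_radial //; under eq_fun do rewrite christoffel0b //.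
  rewrite derive1_cst add0r.
  have -> : (fun s => \tr (weingarten (fun s => G s i p) s)) =
      \sum_k (fun s => weingarten (fun s => G s i p) s k k).
    by apply/funext => s; rewrite fct_sumE.
  rewrite derive1E derive_sum => [|k]; last first.
    apply: C1_derivable; apply: C1_weingarten => [s|a b|a b].
    - exact: posdef_metric.
    - by case: (C1_metric a b ip).
    - by case: (C1_metric a b ip).
  apply: eq_bigr => k _; rewrite partial_radial // derive1E; congr ('D_1 _ r).
  by apply/funext => s; rewrite christoffel_weingarten.
rewrite /shape_norm2 /mxtrace -sumrN.
under eq_bigr => k _.
  under eq_bigr => l _ do rewrite christoffel00 // mulr0 sub0r.
  rewrite sumrN big_split_ord big_ord1 /= christoffel00 // mul0r add0r; over.
rewrite big_split_ord big_ord1 /= big1 ?oppr0 ?add0r => [|l _]; last first.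
  by rewrite christoffel0b // mul0r.
apply: eq_bigr => k _; rewrite [in RHS]mxE; congr (- _).
by apply: eq_bigr => l _; rewrite !christoffel_weingarten.
Qed.

Lemma tr_weingarten_chart i j p r : dom i p -> dom j p ->
  \tr (weingarten (fun s => G s i p) r) = \tr (weingarten (fun s => G s j p) r).
Proof.
move=> ip jp.
apply: (@weingarten_congruence _ _ _ _ (transition_jacobian i j p)) =>
  [s|s|s|a b].
- exact: posdef_metric.
- exact: posdef_metric.
- by case: (hG s) => _ [+ _]; apply.
- by case: (C1_metric a b jp).
Qed.

Lemma mean_curvatureE i p r : dom i p ->
  mean_curvature G r p = \tr (weingarten (fun s => G s i p) r).
Proof.
move=> ip; rewrite -(tr_weingarten_chart r (chart_at_dom p) ip).
by rewrite /mean_curvature /weingarten linearZ.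
Qed.

Lemma continuous_tr_weingarten i r : forall p, dom i p ->
  {for p, continuous (fun q => \tr (weingarten (fun s => G s i q) r))}.
Proof.
have FF := function_field_continuous R (@dom_open i).
apply: (ff_sum FF) => a.
have -> : (fun q => weingarten (fun s => G s i q) r a a) = (fun q =>
    2^-1 * (invmx (G r i q) *m derive1mx (fun s => G s i q) r) a a).
  by apply/funext => q; rewrite mxE.
apply: (ffM FF); first exact: (ff_cst FF).
apply: (ff_mulmx FF) => k l.
  apply: (ff_invmx FF) => [q iq|b c q iq].
    by apply: posdef_unitmx; exact: posdef_metric.
  by case: (continuous_metric r b c iq).
move=> q iq; have := (continuous_metric r k l iq).2.
by apply: near_continuous; apply: nearW => t; rewrite mxE.
Qed.

Lemma continuous_mean_curvature r : continuous (mean_curvature G r).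
Proof.
move=> p; have ip := chart_at_dom p.
suff : {for p, continuous (mean_curvature G r)} by [].
have := continuous_tr_weingarten (r := r) ip; apply: near_continuous.
apply: filterS (open_nbhs_nbhs (conj (@dom_open _) ip)) => q iq.
by rewrite (mean_curvatureE r iq).
Qed.

End cylinder.

(** * The integrated Riccati equation *)

(** The set where f is positive is open, hence empty if it is negligible. *)
Lemma Rintegral_eq0_continuous (R : realType) (f : R -> R) (a b : R) :
  continuous f -> (forall x, 0 <= f x) ->
  \int[@lebesgue_measure R]_(x in `[a, b]) f x = 0 ->
  forall x, a < x < b -> f x = 0.
Proof.
move=> cf f0 If x /andP[ax xb].
have fint : (@lebesgue_measure R).-integrable `[a, b] (EFin \o f).
  apply: continuous_compact_integrable; first exact: segment_compact.
  exact: continuous_subspaceT.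
have Ia : (\int[@lebesgue_measure R]_(x in `[a, b]) `|(f x)%:E| = 0)%E.
  under eq_integral => y _ do rewrite gee0_abs ?lee_fin //.
  by rewrite -[LHS]fineK ?integrable_fin_num //; congr (_%:E).
have [Z [mZ Z0 Zsub]] : ae_eq (@lebesgue_measure R) `[a, b]%classic
    (EFin \o f) (cst 0%E).
  apply/ae_eq_integral_abs => //; exact: measurable_int fint.
apply/eqP; rewrite eq_le f0 andbT leNgt; apply/negP => fx0.
have nU : \forall y \near x, Z y.
  near=> y; apply: Zsub => /= H.
  have yab : `[a, b]%classic y.
    rewrite /= in_itv /=; apply/andP; split; apply: ltW.
      by near: y; exact: lt_nbhsr.
    by near: y; exact: lt_nbhsl.
  have fy0 : 0 < f y by near: y; exact: (cvgr_gt _ (cf x)).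
  by have [] := H yab; apply/eqP; rewrite gt_eqF.
have [e /= e0 eZ] := nU.
have : (0 < @lebesgue_measure R (ball x e))%E.
  by rewrite lebesgue_measure_ball ?ltW // lte_fin pmulrn_lgt0.
rewrite lt_neqAle => /andP[/eqP + _]; apply; apply/esym.
by apply: (subset_measure0 _ mZ) => //; exact: measurable_ball.
Unshelve. all: by end_near. Qed.

(** The comparison argument for an arbitrary function H on R x T, of class C^1
    in r, and functions tau >= 0 (tr W^2 in the application) and
    ric = - H' - tau. *)
Section integrated_riccati.
Context {dT : measure_display} {T : measurableType dT} {R : realType}.
Variable mu : {finite_measure set T -> \bar R}.
Local Notation leb := (@lebesgue_measure R).
Variables (H : R -> T -> R) (tau : T -> R -> R) (ric : R * T -> R).
Hypothesis C1H : forall p, C1 (fun r => H r p).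
Hypothesis tau_ge0 : forall p r, 0 <= tau p r.
Hypothesis tau_cont : forall p, continuous (tau p).
Hypothesis ricE : forall p r,
  ric (r, p) = - derive1 (fun s => H s p) r - tau p r.
Hypothesis intH : forall r, mu.-integrable setT (EFin \o H r).
Hypothesis intric : (leb \x mu)%E.-integrable setT (EFin \o ric).

Let slab (n : nat) : set R := `[- n.+1%:R, n.+1%:R]%classic.

Let ric_slice n p := \int[leb]_(r in slab n) ric (r, p).
Let tau_slice n p := \int[leb]_(r in slab n) tau p r.

Let slab_integrable n (f : R -> R) : continuous f ->
  leb.-integrable (slab n) (EFin \o f).
Proof.
move=> cf; apply: continuous_compact_integrable; first exact: segment_compact.
exact: continuous_subspaceT.
Qed.

Let ric_cont p : continuous (fun r => ric (r, p)).
Proof.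
have -> : (fun r => ric (r, p)) =
    (fun r => - derive1 (fun s => H s p) r - tau p r).
  by apply/funext => r; exact: ricE.
move=> r; apply: cvgB; last exact: tau_cont.
by apply: cvgN; exact: C1_continuous_derive1.
Qed.

Let tau_sliceE n p :
  tau_slice n p = H (- n.+1%:R) p - H n.+1%:R p - ric_slice n p.
Proof.
apply/eqP; rewrite -subr_eq opprK; apply/eqP.
have -> : tau_slice n p + ric_slice n p =
    \int[leb]_(r in slab n) - derive1 (fun s => H s p) r.
  rewrite addrC -RintegralD; [|exact: measurable_itv
    |exact: (slab_integrable n (@ric_cont p))
    |exact: (slab_integrable n (@tau_cont p))].
  by under eq_Rintegral do rewrite ricE subrK.
have cH := C1_continuous (C1H p); have cH' := C1_continuous_derive1 (C1H p).
have lt : - n.+1%:R < n.+1%:R :> R by rewrite -subr_gt0 opprK addr_gt0.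
rewrite /Rintegral (@continuous_FTC2 _ _ (fun r => - H r p) _ _ lt) /=.
- by rewrite opprK addrC.
- by apply: continuous_subspaceT => r; apply: cvgN; exact: cH'.
- split=> [r _||].
  + by apply: derivableN; exact: C1_derivable.
  + by apply: cvg_at_right_filter; apply: cvgN; exact: cH.
  + by apply: cvg_at_left_filter; apply: cvgN; exact: cH.
- move=> r _; rewrite derive1E deriveN ?derive1E //; exact: C1_derivable.
Qed.

(* Fubini is applied to ric only, as tau is not assumed to be measurable on
   R x T. The integral of tau over a slab is integrable in p as a difference of
   integrable functions ([tau_sliceE]). *)
Let strip n : set (measurableTypeR R * T) := slab n `*` setT.

Let measurable_strip n : measurable (strip n).
Proof. by apply: measurableX => //; exact: measurable_itv. Qed.

Let strip_integrable n :
  (leb \x mu)%E.-integrable setT ((EFin \o ric) \_ (strip n)).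
Proof.
apply/(integrable_mkcond _ (measurable_strip n)).
exact: integrableS intric.
Qed.

Let fubini_G_strip n :
  fubini_G leb ((EFin \o ric) \_ (strip n)) = EFin \o ric_slice n.
Proof.
apply/funext => p; rewrite /fubini_G /= /ric_slice /Rintegral fineK; last first.
  apply: integrable_fin_num; first exact: measurable_itv.
  exact: (slab_integrable n (@ric_cont p)).
rewrite [RHS]integral_mkcond; apply: eq_integral => r _.
rewrite /patch; congr (if _ then _ else _).
by apply/idP/idP; rewrite !inE //; case.
Qed.

Let ric_slice_integrable n : mu.-integrable setT (EFin \o ric_slice n).
Proof.
apply/integrableP; split.
  by rewrite -fubini_G_strip; exact: measurable_fubini_G.
have mf := measurable_int _ (strip_integrable n).
apply: le_lt_trans ((integrable21ltyP leb mu mf).1 (strip_integrable n)).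
apply: ge0_le_integral => //.
- rewrite -fubini_G_strip; apply: measurableT_comp => //.
  exact: measurable_fubini_G.
- apply: (@measurable_fun_fubini_tonelli_G _ _ _ _ _ leb
    (abse \o ((EFin \o ric) \_ (strip n)))) => [|z]; last exact: abse_ge0.
  exact: measurableT_comp.
move=> p _; have -> : (EFin \o ric_slice n) p =
  fubini_G leb ((EFin \o ric) \_ (strip n)) p by rewrite fubini_G_strip.
apply: le_abse_integral => //.
exact: (measurable_fun_pair1 p mf).
Qed.

Let ric_sliceI n :
  \int[mu]_p ric_slice n p = \int[(leb \x mu)%E]_(z in strip n) ric z.
Proof.
rewrite /Rintegral [X in _ = fine X]integral_mkcond.
by rewrite -(integral21_prod_meas1 (strip_integrable n)) fubini_G_strip.
Qed.

Let strip_cvg :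
  \int[(leb \x mu)%E]_(z in strip n) ric z @[n --> \oo] -->
  \int[(leb \x mu)%E]_z ric z.
Proof.
have mric : measurable_fun setT (EFin \o ric) := measurable_int _ intric.
have [|||||_ _] := @dominated_convergence _ _ _ (leb \x mu)%E setT measurableT
  (fun n => (EFin \o ric) \_ (strip n)) (EFin \o ric)
  (abse \o (EFin \o ric)) => //.
- by move=> n; exact: measurable_int (strip_integrable n).
- apply: aeW => -[r p] _; apply: cvg_near_cst.
  near=> n; rewrite /patch ifT // inE; split=> //=.
  rewrite /slab /= in_itv /= -ler_norml.
  apply: (@le_trans _ _ n%:R); last by rewrite ler_nat.
  near: n; exact: nbhs_infty_ger.
- exact: integrable_abse.
- apply: aeW => z n _; rewrite /patch; case: ifP => // _.
  by rewrite abse0 abse_ge0.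
rewrite -(fineK (integrable_fin_num measurableT intric)) => /fine_cvgP [_].
have -> : (fine \o (fun n =>
    \int[leb \x mu]_z ((EFin \o ric) \_ (strip n)) z)%E) =
    (fun n => \int[(leb \x mu)%E]_(z in strip n) ric z).
  by apply/funext => n; rewrite /= -integral_mkcond.
by [].
Unshelve. all: by end_near. Qed.

Let intNH r : mu.-integrable setT (EFin \o (fun p => - H r p)).
Proof. exact: integrableN (intH r). Qed.

Let tau_slice_funE n : tau_slice n =
  (fun p => - H n.+1%:R p - - H (- n.+1%:R) p - ric_slice n p).
Proof.
by apply/funext => p; rewrite tau_sliceE opprK [- _ + _]addrC.
Qed.

Let intdNH n : mu.-integrable setT
  (EFin \o (fun p => - H n.+1%:R p - - H (- n.+1%:R) p)).
Proof. exact: (integrableB measurableT (intNH _) (intNH _)). Qed.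

Let tau_slice_integrable n : mu.-integrable setT (EFin \o tau_slice n).
Proof.
rewrite tau_slice_funE; exact: (integrableB measurableT
  (intdNH n) (ric_slice_integrable n)).
Qed.

Let tau_slice_ge0 n p : 0 <= tau_slice n p.
Proof. by apply: Rintegral_ge0 => r _. Qed.

(* The difference of the two sides of the inequality for a bounded slab. *)
Let excess n := \int[mu]_p tau_slice n p.

Let excessE n : excess n =
  \int[mu]_p (- H n.+1%:R p) - \int[mu]_p (- H (- n.+1%:R) p)
  - \int[(leb \x mu)%E]_(z in strip n) ric z.
Proof.
by rewrite /excess tau_slice_funE RintegralB // RintegralB // ric_sliceI.
Qed.

Let tau_slice_nondecreasing p m n :
  (m <= n)%N -> tau_slice m p <= tau_slice n p.
Proof.
move=> mn; apply: fine_le.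
- apply: integrable_fin_num; first exact: measurable_itv.
  exact: (slab_integrable m (@tau_cont p)).
- apply: integrable_fin_num; first exact: measurable_itv.
  exact: (slab_integrable n (@tau_cont p)).
apply: ge0_subset_integral; [exact: measurable_itv|exact: measurable_itv|..].
- exact: measurable_int (slab_integrable n (@tau_cont p)).
- by move=> r _; rewrite lee_fin.
- by apply: subset_itv; rewrite bnd_simp ?lerN2 ler_nat.
Qed.

Variables Mminus Mplus : R.
Hypothesis Hminus : \int[mu]_p (- H r p) @[r --> -oo%R] --> Mminus.
Hypothesis Hplus : \int[mu]_p (- H r p) @[r --> +oo%R] --> Mplus.

Let excess_cvg :
  excess n @[n --> \oo] --> Mplus - Mminus - \int[(leb \x mu)%E]_z ric z.
Proof.
have n_oo : (n.+1%:R : R) @[n --> \oo] --> +oo%R.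
  by rewrite (@cvg_shiftS R (fun n => n%:R)); exact: cvgr_idn.
under eq_fun do rewrite excessE.
apply: cvgB; last exact: strip_cvg.
have n_Noo : (- n.+1%:R : R) @[n --> \oo] --> -oo%R by apply/cvgNrNy.
apply: cvgB; first exact: (cvg_comp _ _ n_oo Hplus).
exact: (cvg_comp _ _ n_Noo Hminus).
Qed.

Let excess_le n : 0 <= excess n <= Mplus - Mminus - \int[(leb \x mu)%E]_z ric z.
Proof.
apply/andP; split; first by apply: Rintegral_ge0 => p _; exact: tau_slice_ge0.
rewrite -(cvg_lim (@Rhausdorff R) excess_cvg).
apply: nondecreasing_cvgn_le; last by apply/cvg_ex; eexists; exact: excess_cvg.
move=> k m km; apply: le_Rintegral => // p _; exact: tau_slice_nondecreasing.
Qed.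

Lemma integrated_riccati_le :
  \int[(leb \x mu)%E]_z ric z <= Mplus - Mminus.
Proof.
by rewrite -subr_ge0; have /andP[/le_trans] := excess_le 0; apply.
Qed.

Lemma integrated_riccati_eq :
  Mplus - Mminus = \int[(leb \x mu)%E]_z ric z ->
  {ae mu, forall p, forall r, tau p r = 0}.
Proof.
move=> ME; have slice0 n : {ae mu, forall p, tau_slice n p = 0}.
  have e0 : excess n = 0.
    by apply/eqP; rewrite eq_le andbC; have := excess_le n; rewrite ME subrr.
  have Ia : (\int[mu]_p `|(tau_slice n p)%:E| = 0)%E.
    under eq_integral => y _ do rewrite gee0_abs ?lee_fin //.
    have fin := integrable_fin_num measurableT (tau_slice_integrable n).
    by rewrite -[LHS](fineK fin); congr (_%:E).
  have : ae_eq mu setT (EFin \o tau_slice n) (cst 0%E).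
    apply/ae_eq_integral_abs => //.
    exact: measurable_int (tau_slice_integrable n).
  by apply: filterS => p /(_ I) [].
have : {ae mu, forall p, forall n, tau_slice n p = 0} by apply/ae_foralln.
apply: filterS => p tau0 r.
pose n := Num.truncn `|r|.
apply: (@Rintegral_eq0_continuous R (tau p) (- n.+1%:R) n.+1%:R (@tau_cont p)
  (tau_ge0 p) (tau0 n)).
by rewrite -ltr_norml truncnS_gt.
Qed.

End integrated_riccati.

(** * Positivity of the Riemannian measure on open sets *)

(** The integral of a nonnegative function is a supremum over the simple
    functions below it, so that it is monotone without measurability. This
    applies to iterated integrals, whose inner integrals are not known to be
    measurable functions. *)
Lemma ge0_le_integral_nonmeasurable (dT : measure_display)
    (T : measurableType dT) (R : realType) (mu : {measure set T -> \bar R})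
    (f g : T -> \bar R) :
  (forall x, 0 <= f x)%E -> (forall x, f x <= g x)%E ->
  (\int[mu]_x f x <= \int[mu]_x g x)%E.
Proof.
move=> f0 fg; have g0 x : (0 <= g x)%E by exact: le_trans (fg x).
rewrite !ge0_integralTE //; apply: ge_ereal_sup => _ [h /= hf <-].
by apply: ereal_sup_ubound; exists h => // x; exact: le_trans (fg x).
Qed.

Lemma integral_rV_ge0 (R : realType) (d : nat) (f : 'rV[R]_d -> \bar R) :
  (forall x, 0 <= f x)%E -> (0 <= integral_rV f)%E.
Proof.
elim: d f => [|d IH] f f0 //=.
by apply: integral_ge0 => t _; apply: IH.
Qed.

(** The bound m does not depend on f: this is what allows the induction on the
    dimension, where it is applied to all the sections of f at once. *)
Lemma integral_rV_box (R : realType) (d : nat) (a b : 'I_d -> R) (c : R) :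
  (forall k, a k < b k) -> 0 < c ->
  exists2 m : R, 0 < m & forall f : 'rV[R]_d -> R, (forall x, 0 <= f x) ->
    (forall x : 'rV[R]_d, (forall k, a k <= x ord0 k <= b k) -> c <= f x) ->
    (m%:E <= integral_rV (EFin \o f))%E.
Proof.
elim: d a b => [|d IH] a b ab c0.
  by exists c => // f f0 cf /=; rewrite lee_fin; apply: cf => -[].
have [m m0 mf] := IH (fun k => a (rshift 1 k)) (fun k => b (rshift 1 k))
  (fun k => ab (rshift 1 k)) c0.
pose i0 : 'I_(1 + d) := lshift d ord0.
exists (m * (b i0 - a i0)); first by rewrite mulr_gt0 // subr_gt0.
move=> f f0 cf /=.
have -> : ((m * (b i0 - a i0))%:E =
    \int[@lebesgue_measure R]_t (m * \1_(`[a i0, b i0]%classic) t)%:E)%E.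
  under eq_integral do rewrite EFinM.
  rewrite ge0_integralZl_EFin //; last 2 first.
  - by apply/measurable_EFinP; apply: measurable_indic; exact: measurable_itv.
  - exact: ltW.
  rewrite integral_indic // setIT.
  by rewrite /= lebesgue_measure_itv /= lte_fin ab -EFinD EFinM.
apply: ge0_le_integral_nonmeasurable => t.
  by rewrite lee_fin mulr_ge0 // ltW.
rewrite indicE; have [|_] := boolP (t \in _); last first.
  by rewrite mulr0; apply: integral_rV_ge0 => y; rewrite lee_fin.
rewrite inE /= in_itv /= => tab; rewrite mulr1.
apply: (mf (fun y => f (cyl_point t y))) => // y yab; apply: cf => k.
have := @splitK 1 d k; case: fintype.split => j /= <-.
  by rewrite (ord1 j) (@row_mxEl _ 1 1 d) mxE eqxx.
by rewrite (@row_mxEr _ 1 1 d); exact: yab.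
Qed.

Lemma smooth_on_within_continuous (R : realType) (d : nat) (Y : set 'rV[R]_d)
    (f : 'rV[R]_d -> R) :
  smooth_on Y f -> {within Y, continuous f}.
Proof.
move=> sf; apply/subspace_continuousP => x Yx.
have [V [F [oV Vx FC Ff]]] := sf x Yx.
have cF : F y @[y --> within Y (nbhs x)] --> f x.
  have := Ff x Yx Vx => <-; have [cF _] := FC 0%N.
  exact: (cvg_trans (cvg_app F (cvg_within _)) (cF x Vx)).
apply: cvg_trans cF; apply: near_eq_cvg.
have nV : \forall y \near x, V y := open_nbhs_nbhs (conj oV Vx).
suff : \forall y \near x, Y y -> F y = f y by [].
by apply: filterS nV => y Vy Yy; exact: Ff.
Qed.

Section riemannian_measure.
Context {R : realType} {N : ptopologicalType} {d : nat} (A : atlas R N d).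
Hypothesis hN : is_smooth_manifold A.
Variable g : tensor A.
Hypothesis g_riem : is_riemannian g.
Variable mu : {measure set (borelType N) -> \bar R}.
Hypothesis hmu : is_riemannian_measure g mu.

(** In a chart, the density of the measure is bounded below near the image of a
    point of U. *)
Lemma riemannian_measure_open_gt0 (U : set N) : open U -> U !=set0 ->
  (0 < mu U)%E.
Proof.
move=> oU [p Up]; pose i := chart_at A p.
have ip : dom i p by exact: chart_at_dom.
pose B := U `&` dom i.
have oB : open B by apply: openI => //; exact: dom_open.
have mB : measurable (B : set (borelType N)) by exact: sub_sigma_algebra.
have mU : measurable (U : set (borelType N)) by exact: sub_sigma_algebra.
suff : (0 < mu B)%E.
  by move=> /lt_le_trans; apply; apply: le_measure; rewrite ?inE // => q [].
rewrite (@hmu i B mB); last by move=> q [].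
pose Y := coord i @` dom i.
pose dens (x : 'rV[R]_d) := Num.sqrt (\det (g i (param i x))).
pose f (x : 'rV[R]_d) : R := \1_(coord i @` B) x * dens x.
have y0 : Y (coord i p) by exists p.
have posg q : dom i q -> 0 < \det (g i q).
  move=> iq; have : posdef (g i q) by case: g_riem => _ [_ +]; apply.
  move=> /cholesky [C uC ->]; rewrite det_mulmx det_tr -expr2.
  by rewrite exprn_even_gt0 //= -unitfE -unitmxE.
have dens0 : 0 < dens (coord i p) by rewrite sqrtr_gt0 coordK // posg.
have cdens : {within Y, continuous dens}.
  have FF := @function_field_continuous R (subspace Y) setT openT.
  have cdet : forall t : subspace Y, setT t -> {for t, continuous
      (fun x : subspace Y => \det (g i (param i x)))}.
    apply: (ff_det FF) => a b t _.
    by apply: smooth_on_within_continuous; case: g_riem => + _; apply.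
  move=> t; apply: (continuous_comp (cdet t I)); exact: sqrt_continuous.
have cpar : {within Y, continuous (param i)}.
  by case: hN => _ [_ [_ [/(_ i) [_ [_ [_ [_ +]]]] _]]].
have nf : \forall x \near coord i p, Y x -> dens (coord i p) / 2 <= f x.
  have n1 : \forall x \near coord i p, Y x -> B (param i x).
    have nB : nbhs (param i (coord i p)) B.
      by rewrite coordK //; apply: open_nbhs_nbhs.
    by have /subspace_continuousP /(_ _ y0) c := cpar; exact: (c B nB).
  have n2 : \forall x \near coord i p, Y x -> dens (coord i p) / 2 < dens x.
    have /subspace_continuousP /(_ _ y0) := cdens.
    by move=> /cvgr_gt; apply; rewrite ltr_pdivrMr // ltr_pMr // ltr1n.
  apply: filterS2 n1 n2 => x Bx dx Yx; rewrite /f indicE mem_set ?mul1r.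
    exact: ltW (dx Yx).
  exists (param i x); first exact: Bx.
  by case: Yx => q iq <-; rewrite coordK.
have [V oV VE] := coord_image hN i.
have nV : \forall x \near coord i p, V x.
  by apply: open_nbhs_nbhs; split=> //; move: y0; rewrite /Y VE => -[].
have /nbhs_ballP [e /= e0 eV] : nbhs (coord i p) [set x | V x /\
    (Y x -> dens (coord i p) / 2 <= f x)] by apply: filterI.
have e4 : e / 4 < e / 2 by rewrite ltr_pM2l // ltf_pV2 ?posrE // ltr_nat.
pose y := coord i p.
(* The box is off the point y, in the direction of increasing coordinates: it
   lies in the half-space even if y is a boundary point. *)
have [||m m0 mf] := @integral_rV_box R d (fun k => y ord0 k + e / 4)
  (fun k => y ord0 k + e / 2) (dens (coord i p) / 2).
- by move=> k; rewrite ltrD2l.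
- by rewrite divr_gt0.
apply: lt_le_trans (_ : (0 < m%:E)%E) _; first by rewrite lte_fin.
apply: mf => [x|x xbox].
  by rewrite mulr_ge0 // ?sqrtr_ge0 // indicE.
have [] := eV x; last first.
  move=> Vx; apply; rewrite /Y VE; split=> // k kd.
  have /andP[+ _] := xbox k; apply: le_trans.
  have : half_space R d y by move: y0; rewrite /Y VE => -[].
  by move=> /(_ k kd) y_ge0; rewrite addr_ge0 // divr_ge0 // ltW.
split=> // a k; rewrite (ord1 a) /ball /= distrC ltr_norml.
have /andP[x1 x2] := xbox k.
apply/andP; split; lra.
Qed.

Lemma riemannian_measure_ae_dense (P : N -> Prop) (U : set N) :
  {ae mu, forall p, P p} -> open U -> U !=set0 -> exists2 p, U p & P p.
Proof.
move=> [Z [mZ Z0 PZ]] oU U0; have := riemannian_measure_open_gt0 oU U0.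
apply: contraPP => nP; rewrite lt_neqAle => /andP[/eqP + _]; apply.
apply/esym; apply: (subset_measure0 _ mZ) => //.
  exact: sub_sigma_algebra.
by move=> p Up; apply: PZ => Pp; apply: nP; exists p.
Qed.

End riemannian_measure.

(** * Comparison of the masses at both ends *)

Lemma continuous_borel_measurable (R : realType) (N : ptopologicalType)
    (f : N -> R) :
  continuous f -> measurable_fun [set: borelType N] (f : borelType N -> R).
Proof.
move=> /continuousP cf; apply: (measurability _ (RGenOpens.measurableE R)).
move=> _ [_ [a [b ->] <-]]; rewrite setTI; apply: sub_sigma_algebra.
exact/cf/interval_open.
Qed.

Lemma continuous_compact_integrable_borel (R : realType) (N : ptopologicalType)
    (mu : {finite_measure set (borelType N) -> \bar R}) (f : N -> R) :
  compact [set: N] -> continuous f ->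
  mu.-integrable setT (EFin \o (f : borelType N -> R)).
Proof.
move=> cN cf; apply: measurable_bounded_integrable => //.
- by rewrite ltey_eq fin_num_measure.
- exact: continuous_borel_measurable.
have : compact (f @` [set: N]).
  by apply: continuous_compact cN; exact: continuous_subspaceT.
move=> /compact_bounded [M [Mreal Mf]]; exists M; split=> // x Mx p _.
by apply: (Mf x Mx); exists p.
Qed.

Section comparison.
Context {R : realType} {N : ptopologicalType} {d : nat} {A : atlas R N d}.
Hypotheses (hN : is_smooth_manifold A) (cN : compact [set: N]).
Variables (Ghat : tensor A) (mu : {finite_measure set (borelType N) -> \bar R}).
Hypotheses (hGhat : is_riemannian Ghat) (hmu : is_riemannian_measure Ghat mu).
Variable G : R -> tensor A.
Hypothesis hG : forall r : R, is_riemannian (G r).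
Hypothesis hg : is_riemannian (cyl_metric G).

Let tau (p : N) := shape_norm2 G (chart_at A p) p.

Let C1_weingarten_chart p a b :
  C1 (fun r => weingarten (fun s => G s (chart_at A p) p) r a b).
Proof.
have ip := chart_at_dom hN p; apply: C1_weingarten => [r|k l|k l].
- exact: posdef_metric.
- by case: (C1_metric hN hg k l ip).
- by case: (C1_metric hN hg k l ip).
Qed.

Let mean_curvature_chart p : (fun r => mean_curvature G r p) =
  (fun r => \tr (weingarten (fun s => G s (chart_at A p) p) r)).
Proof.
by apply/funext => r; apply: mean_curvatureE => //; exact: chart_at_dom.
Qed.

Let C1_mean_curvature p : C1 (fun r => mean_curvature G r p).
Proof.
rewrite mean_curvature_chart; apply: (ff_sum (@function_field_C1 R)) => a.
exact: C1_weingarten_chart.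
Qed.

Let tau_ge0 p r : 0 <= tau p r.
Proof.
have ip := chart_at_dom hN p.
by apply: (tr_weingarten_sqr (K := fun s => G s (chart_at A p) p) r _).1 => s;
  exact: posdef_metric.
Qed.

Let tau_continuous p : continuous (tau p).
Proof.
apply: C1_continuous; apply: (ff_sum (@function_field_C1 R)) => a.
apply: (ff_mulmx (@function_field_C1 R)) => k l; exact: C1_weingarten_chart.
Qed.

Let mean_curvature_integrable r :
  mu.-integrable setT (EFin \o (mean_curvature G r : borelType N -> R)).
Proof.
apply: continuous_compact_integrable_borel => //.
exact: continuous_mean_curvature.
Qed.

Let ricci_riccati p r : radial_ricci G (r, p) =
  - derive1 (fun s => mean_curvature G s p) r - tau p r.
Proof. by rewrite riccati // mean_curvature_chart. Qed.

Lemma relative_radial_massE r :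
  relative_radial_mass mu (fun=> 1) G r = \int[mu]_p (- mean_curvature G r p).
Proof.
apply: eq_Rintegral => p _.
by rewrite /model_mean_curvature derive1_cst mul0r mulr0 expr1n mul1r sub0r.
Qed.

(* The metric is constant in r in the chart used by [tau], hence in every chart
   around p, as the transition maps do not depend on r. *)
Let metric_const_chart p : (forall r, tau p r = 0) ->
  forall j, dom j p -> forall r, G r j p = G 0 j p.
Proof.
move=> tau0; have ip := chart_at_dom hN p; set i := chart_at A p in ip.
have GK r : G r i p = G 0 i p.
  apply/matrixP => a b.
  have dG s : is_derive s (1 : R) (fun r => G r i p a b) 0.
    have K' : derive1mx (fun s => G s i p) s = 0.
      by apply: (tr_weingarten_sqr s _).2 (tau0 s) => u; exact: posdef_metric.
    have [CG _] := C1_metric hN hg a b ip.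
    split; first exact: C1_derivable.
    by move/matrixP/(_ a b): K'; rewrite !mxE derive1E.
  exact: (is_derive_0_is_cst r 0 dG).
move=> j jp r.
have tr s : G s j p = (transition_jacobian j i p)^T *m G s i p
    *m transition_jacobian j i p by case: (hG s) => _ [+ _]; apply.
by rewrite tr GK -tr.
Qed.

(** The set of points where the metric does not depend on r is dense, and it is
    closed by continuity. *)
Lemma is_product_of_ae :
  {ae mu, forall p, forall r, tau p r = 0} -> is_product G.
Proof.
move=> tau0; exists (G 0); split=> // r j p jp; apply/matrixP => a b.
have [//|ne] := eqVneq (G r j p a b) (G 0 j p a b).
pose phi q := G r j q a b - G 0 j q a b.
have cphi : {for p, continuous phi}.
  by apply: cvgB; [exact: (continuous_metric hN hg r a b jp).1|
    exact: (continuous_metric hN hg 0 a b jp).1].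
have nphi : \forall q \near p, phi q != 0.
  by apply: (cvgr_neq0 _ cphi); rewrite subr_eq0.
have : nbhs p [set q | dom j q /\ phi q != 0].
  apply: filterI nphi.
  by apply: open_nbhs_nbhs; split=> //; exact: dom_open.
rewrite nbhsE /= => -[U [oU Up] Usub].
have [q /Usub [jq phiq] tq] :=
  riemannian_measure_ae_dense hN hGhat hmu tau0 oU (ex_intro _ p Up).
by move: phiq; rewrite /phi (metric_const_chart tq jq) subrr eqxx.
Qed.

Lemma weingarten_product p r : is_product G ->
  weingarten (fun s => G s (chart_at A p) p) r = 0.
Proof.
move=> [Gt [_ GE]]; rewrite /weingarten.
have -> : derive1mx (fun s => G s (chart_at A p) p) r = 0.
  apply/matrixP => a b; rewrite !mxE.
  have -> : (fun s => G s (chart_at A p) p a b) =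
      (fun=> Gt (chart_at A p) p a b).
    by apply/funext => s; rewrite GE //; exact: chart_at_dom.
  exact: derive1_cst.
by rewrite mulmx0 scaler0.
Qed.

Lemma mean_curvature_product r p : is_product G -> mean_curvature G r p = 0.
Proof.
move=> pG; rewrite (mean_curvatureE hN hG hg r (chart_at_dom hN p)).
by rewrite weingarten_product // linear0.
Qed.

Lemma radial_ricci_product z : is_product G -> radial_ricci G z = 0.
Proof.
case: z => r p pG; rewrite ricci_riccati.
under eq_fun do rewrite mean_curvature_product //.
rewrite derive1_cst /tau /shape_norm2 weingarten_product //.
by rewrite mulmx0 mxtrace0 oppr0 addr0.
Qed.

Variables Mminus Mplus : R.
Hypothesis hminus :
  relative_radial_mass mu (fun=> 1) G r @[r --> -oo%R] --> Mminus.
Hypothesis hplus :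
  relative_radial_mass mu (fun=> 1) G r @[r --> +oo%R] --> Mplus.
Hypothesis hL1 : (@lebesgue_measure R \x mu)%E.-integrable setT
  (EFin \o radial_ricci G).
Let I := \int[(@lebesgue_measure R \x mu)%E]_z radial_ricci G z.

Let hminus' : \int[mu]_p (- mean_curvature G r p) @[r --> -oo%R] --> Mminus.
Proof. by under eq_fun do rewrite -relative_radial_massE. Qed.

Let hplus' : \int[mu]_p (- mean_curvature G r p) @[r --> +oo%R] --> Mplus.
Proof. by under eq_fun do rewrite -relative_radial_massE. Qed.

Lemma radial_mass_ge : Mplus - Mminus >= I.
Proof.
exact: (@integrated_riccati_le _ (borelType N) R mu (mean_curvature G) tau
  (radial_ricci G) C1_mean_curvature tau_ge0 tau_continuous
  ricci_riccati mean_curvature_integrable hL1 Mminus Mplus hminus' hplus').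
Qed.

Lemma radial_mass_eq : Mplus - Mminus = I <-> is_product G.
Proof.
split=> [eqI|pG].
  apply: is_product_of_ae.
  exact: (@integrated_riccati_eq _ (borelType N) R mu (mean_curvature G) tau
    (radial_ricci G) C1_mean_curvature tau_ge0 tau_continuous ricci_riccati
    mean_curvature_integrable hL1 Mminus Mplus hminus' hplus' eqI).
have M0 r : relative_radial_mass mu (fun=> 1) G r = 0.
  rewrite relative_radial_massE.
  under eq_Rintegral do rewrite mean_curvature_product // oppr0.
  by rewrite Rintegral_cst // mul0r.
have -> : Mminus = 0.
  rewrite -(cvg_lim (@Rhausdorff R) hminus); under eq_fun do rewrite M0.
  exact: lim_cst.
have -> : Mplus = 0.
  rewrite -(cvg_lim (@Rhausdorff R) hplus); under eq_fun do rewrite M0.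
  exact: lim_cst.
rewrite subrr /I /Rintegral.
under eq_integral do rewrite radial_ricci_product //.
by rewrite integral0.
Qed.

(** The distance of G(r) to Ghat at a point does not depend on r and is
    arbitrarily small. *)
Lemma asymptotic_product (r0 : \bar R) (Gt : tensor A) :
  is_riemannian Gt -> (forall r, tensor_eq (G r) Gt) ->
  asymptotic (fun=> 1) Ghat G r0 -> tensor_eq Gt Ghat.
Proof.
move=> hGt GE asy.
have Gt_chart p : Gt (chart_at A p) p = Ghat (chart_at A p) p.
  set i := chart_at A p; have ip : dom i p := chart_at_dom hN p.
  have pos : posdef (Ghat i p) by case: hGhat => _ [_ +]; apply.
  have posG : posdef (Gt i p) by case: hGt => _ [_ +]; apply.
  pose S := Gt i p - Ghat i p.
  have Ssym : S^T = S by rewrite /S linearB /= pos.1 posG.1.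
  have [t_ge0 t_eq0] := tr_invmx_sqr pos Ssym.
  apply/eqP; rewrite -subr_eq0; apply/eqP; apply: t_eq0.
  set t := \tr _ in t_ge0 *.
  have tE r : tensor_norm (warped (fun=> 1) Ghat r)
      (fun i q => G r i q - warped (fun=> 1) Ghat r i q) p = Num.sqrt t.
    by rewrite /tensor_norm /warped expr1n !scale1r (GE r _ _ ip) -/S Ssym.
  apply/eqP; rewrite eq_le t_ge0 andbT -sqrtr_eq0 eq_le sqrtr_ge0 andbT.
  apply/ler_addgt0Pr => eps eps0; rewrite add0r.
  have FF : ProperFilter (approach r0) by case: (r0) => [r||] /=; exact _.
  have [r /(_ p)] := filter_ex (asy eps eps0).
  by rewrite tE.
move=> j p jp; have ip := chart_at_dom hN p.
case: hGt => _ [Gt_tr _]; case: hGhat => _ [Ghat_tr _].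
by rewrite (Gt_tr j (chart_at A p)) // (Ghat_tr j (chart_at A p)) // Gt_chart.
Qed.
End comparison.

Theorem corollary5p3 (R : realType) (n : nat) (hn : (2 <= n)%N)
  (N : ptopologicalType) (A : atlas R N n.-1)
  (hN : is_smooth_manifold A) (cN : compact [set: N])
  (Ghat : tensor A) (hGhat : is_riemannian Ghat)
  (mu : {finite_measure set (borelType N) -> \bar R})
  (hmu : is_riemannian_measure Ghat mu)
  (G : R -> tensor A) (hG : forall r : R, is_riemannian (G r))
  (hg : is_riemannian (cyl_metric G))
  (Mminus Mplus : R)
  (hminus : relative_radial_mass mu (fun=> 1) G r @[r --> -oo%R] --> Mminus)
  (hplus : relative_radial_mass mu (fun=> 1) G r @[r --> +oo%R] --> Mplus)
  (hL1 : (@lebesgue_measure R \x mu)%E.-integrable setT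
           (EFin \o radial_ricci G)) :
  let I := \int[(@lebesgue_measure R \x mu)%E]_z radial_ricci G z in
  [/\ Mplus - Mminus >= I,
      Mplus - Mminus = I <-> is_product G
    & forall r0 : \bar R, asymptotic (fun=> 1) Ghat G r0 ->
        (Mplus - Mminus = I <->
         tensor_eq (cyl_metric G) (cyl_metric (warped (fun=> 1) Ghat)))].
Proof.
move=> I; have mass_eq : Mplus - Mminus = I <-> is_product G.
  exact: (radial_mass_eq hN cN hGhat hmu hG hg hminus hplus hL1).
split; [|exact: mass_eq|move=> r0 asy].
  exact: (radial_mass_ge hN cN hG hg hminus hplus hL1).
rewrite mass_eq; split=> [[Gt [hGt GE]] i [r p] ip|cylE].
  rewrite /cyl_metric /warped expr1n scale1r (GE r i p ip).
  by rewrite (asymptotic_product hN hGhat hGt GE asy ip).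
exists Ghat; split=> // r i p ip.
have := cylE i (r, p) ip.
rewrite /cyl_metric /warped expr1n scale1r /= => E.
by have [] := eq_block_mx E.
Qed.
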